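(* Let $q$ be an integer greater than $3$ and let $A_q=\{q^i: i\in\mathbb{N}\}$. Write $A_q=\{a_1,a_2,\ldots\}$ in increasing order, so $a_i=q^{i-1}$. Then $$2a_{s-1}+4a_{s-2}+6a_{s-3}+\cdots+2(s-1)a_1<a_s$$ for all $s\ge 2$ (that is, $\sum_{i=1}^{s-1}2i\,a_{s-i}<a_s$ for all $s\ge 2$). Consequently, $P(m,n,A_q)\le F(n)$ for all positive integers $m,n$.
   Context: $\mathbb{N}$ denotes the non-negative integers, so $A_q=\{1,q,q^2,\ldots\}$. For a set $A$ of positive integers and positive integers $m,n$, $P(m,n,A)$ denotes the number of partitions of $m$ into at most $n$ parts from $A$, i.e. the number of ways to write $m=\alpha_1+\alpha_2+\cdots+\alpha_t$ with $t\le n$, $\alpha_1\le\alpha_2\le\cdots\le\alpha_t$, and all $\alpha_i\in A$ (not necessarily distinct). Equivalently, writing $A=\{a_1<a_2<\cdots\}$, it is the number of sequences $(x_i)$ of non-negative integers with $\sum_i x_ia_i=m$ and $\sum_i x_i\le n$. $F(n)$ is the $n$-th Fibonacci number: $F(1)=F(2)=1$, $F(n)=F(n-1)+F(n-2)$ for $n\ge 3$, and $F(i)=0$ for all integers $i\le 0$. *)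

(* Defs.v *)
From mathcomp Require Import all_boot.
From mathcomp Require Import finmap.
From mathcomp Require Import boolp classical_sets functions cardinality.

Set Implicit Arguments.
Unset Strict Implicit.
Unset Printing Implicit Defensive.

Local Open Scope classical_set_scope.
Local Open Scope card_scope.

Definition is_partition (m n : nat) (A : set nat) (s : seq nat) : Prop :=
  [/\ sorted leq s, (size s <= n)%N, (forall x, x \in s -> A x) & sumn s = m].

(* A part of a partition of [m] is at most [m], so drawing the parts from
   ['I_m.+1] loses nothing; see [card_partitions]. *)
Definition P (m n : nat) (A : set nat) : nat :=
  #|[pred t : n.-bseq 'I_m.+1 |
      `[< is_partition m n A [seq (val i : nat) | i <- t] >]]|.

Lemma card_partitions (m n : nat) (A : set nat) :
  [set s | is_partition m n A s] #= `I_(P m n A).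
Proof.
pose f (t : n.-bseq 'I_m.+1) : seq nat := [seq (val i : nat) | i <- t].
have finj : injective f.
  by move=> t u /(inj_map val_inj) E; apply: val_inj.
pose D := [pred t : n.-bseq 'I_m.+1 | `[< is_partition m n A (f t) >]].
have -> : [set s | is_partition m n A s] = f @` [set` D].
  apply/seteqP; split => s /=; last first.
    by case=> t /= /asboolP tD <-.
  move=> Hs; have [_ sz _ sm] := Hs.
  have le_m x : x \in s -> (x < m.+1)%N.
    by move=> xs; rewrite ltnS -sm sumnE (big_rem x) //= leq_addr.
  pose t0 : seq 'I_m.+1 := [seq inord x | x <- s].
  have sz0 : (size t0 <= n)%N by rewrite size_map.
  have fE : f (Bseq sz0) = s.
    rewrite /f /= -map_comp -[RHS]map_id; apply/eq_in_map => x xs /=.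
    by rewrite inordK // le_m.
  by exists (Bseq sz0) => //=; apply/asboolP; rewrite fE.
apply: card_eq_trans; first by apply: inj_card_eq; apply: in2W.
suff -> : [set` D] = [set` [fset x in enum D]%fset].
  by apply/card_eq_fsetP; rewrite card_fseq undup_id ?enum_uniq // -cardE.
by apply/seteqP; split => t /=; rewrite in_fset_ /= mem_enum.
Qed.

Definition powers (q : nat) : set nat := range (fun i : nat => q ^ i).

(* Indices of the sequence [a] start at 1; [a 0] is irrelevant. *)
Definition increasing_enumeration (A : set nat) (a : nat -> nat) : Prop :=
  {in [pred i | 0 < i] &, {homo a : i j / i < j}} /\
  [set a i | i in [set i | 0 < i]] = A.

Fixpoint F (n : nat) : nat :=
  match n with
  | 0 => 0
  | 1 => 1
  | (n'.+1 as n1).+1 => F n1 + F n'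
  end.

(* Main.v *)
Require Import Defs.
From mathcomp Require Import all_boot.
From mathcomp Require Import classical_sets.
From mathcomp Require Import finmap cardinality zify.

(** The Fibonacci bound holds for every increasing sequence of positive
    integers [a 1 < a 2 < ...] that grows so fast that
    [2 * a (s - 1) + 4 * a (s - 2) + ... + 2 * (s - 1) * a 1 < a s]; powers of
    [q > 3] are an instance.

    The bound on [P m n A] is by induction on the number [n] of parts allowed,
    for all [m] at once. Let [a s] be the largest element of [A] that is at
    most [m].

    Partitions containing [a s] inject, by deleting one copy of it, into the
    partitions of [m - a s] with at most [n - 1] parts: there are at most
    [F (n - 1)].

    A partition without [a s] has all its parts among [a 1, ..., a (s - 1)].
    If each [a (s - i)] occurred at most [2 * i] times, growth would make the
    sum of the parts smaller than [a s <= m]. So some [a (s - i)] occurs at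
    least [2 * i + 1] times ([frequent_part]), and deleting [2 * i + 1] copies
    of it leaves at most [n - (2 * i + 1)] parts. There are therefore at most
    [F (n - 3) + F (n - 5) + ... <= F (n - 2)] such partitions ([sum_F_le]),
    and the two cases add up to [F n].

    The deletions may leave the empty partition with no part allowed, and
    [P 0 0 A = 1] exceeds [F 0 = 0]. The induction therefore runs with
    [F n + (n == 0)], the Fibonacci sequence whose value at 0 is raised to 1.
    The alternate sums of this sequence still satisfy the estimate above,
    because [F 0 + F 2 + ... + F (2 * k) = F (2 * k + 1) - 1] leaves room for
    the extra unit. *)

Set Implicit Arguments.
Unset Strict Implicit.

(** * Counting partitions by lists *)

(** Duplicate-free lists of partitions can be filtered and mapped, which makes
    the injections of the main argument direct. *)
Lemma exists_partition_list (m n : nat) (A : set nat) :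
  exists L : seq (seq nat),
    [/\ uniq L, forall t, t \in L <-> is_partition m n A t
      & size L = P m n A].
Proof.
have /finite_fsetP[X XE] : finite_set [set s | is_partition m n A s].
  by exists (P m n A); apply: card_partitions.
have sX : #|` X|%fset = P m n A.
  by apply/card_eq_fsetP; rewrite -XE card_partitions.
exists X; split => [||//]; first exact: fset_uniq.
move=> t.
change ([set` X]%classic t <-> is_partition m n A t).
by rewrite -XE.
Qed.

Lemma size_partitions_le (m n : nat) (A : set nat) (L : seq (seq nat)) :
  uniq L -> {in L, forall t, is_partition m n A t} -> size L <= P m n A.
Proof.
move=> uL LP; have [L' [_ L'P <-]] := exists_partition_list m n A.
by apply: uniq_leq_size => // t /LP /L'P.
Qed.

Lemma is_partition_rem (m n x : nat) (A : set nat) (t : seq nat) :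
  is_partition m n A t -> x \in t -> is_partition (m - x) n.-1 A (rem x t).
Proof.
case=> st szt tA smt xt; split.
- exact: subseq_sorted leq_trans _ _ (rem_subseq x t) st.
- by rewrite size_rem // -!subn1 leq_sub2r.
- by move=> y /mem_rem; apply: tA.
- by rewrite -smt (perm_sumn (perm_to_rem xt)) /= addKn.
Qed.

(** Deleting one copy of [x] from partitions that contain it is injective,
    since a partition is determined by its multiset of parts; repeat [c] times.
    The truncated subtractions are harmless: they truncate only when [L] is
    empty. *)
Lemma size_partitions_copies_le (c m n x : nat) (A : set nat)
    (L : seq (seq nat)) :
  uniq L ->
  {in L, forall t, is_partition m n A t /\ c <= count_mem x t} ->
  size L <= P (m - c * x) (n - c) A.
Proof.
elim: c => [|c IHc] in m n L * => uL LP.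
  by rewrite mul0n !subn0; apply: size_partitions_le => // t /LP[].
have xL t : t \in L -> x \in t.
  by move=> /LP[_ ct]; rewrite -has_pred1 has_count; lia.
have -> : m - c.+1 * x = (m - x) - c * x by rewrite mulSn subnDA.
have -> : n - c.+1 = n.-1 - c by lia.
rewrite -(size_map (rem x) L); apply: IHc.
  rewrite map_inj_in_uniq // => t u tL uL' E.
  have [[st _ _ _] _] := LP t tL; have [[su _ _ _] _] := LP u uL'.
  apply: (sorted_eq leq_trans anti_leq) => //.
  rewrite (permPl (perm_to_rem (xL t tL))) E perm_sym.
  exact: perm_to_rem (xL u uL').
move=> _ /mapP[t tL ->]; have [tP ct] := LP t tL.
split; first exact: is_partition_rem (xL t tL).
by move: ct; rewrite (permP (perm_to_rem (xL t tL))) /= eqxx add1n ltnS.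
Qed.

(** The union bound. The index filter [Q] carries the constraint that enough
    parts are available for the deletion. *)
Lemma size_le_sum_count (T I : eqType) (L : seq T) (r : seq I) (Q : pred I)
    (p : I -> pred T) :
  {in L, forall t, exists i, [/\ i \in r, Q i & p i t]} ->
  size L <= \sum_(i <- r | Q i) count (p i) L.
Proof.
elim: L => [|t L IH] //= cov.
have {}IH : size L <= \sum_(i <- r | Q i) count (p i) L.
  by apply: IH => u uL; apply: cov; rewrite inE uL orbT.
have [i [ir Qi pit]] := cov t (mem_head _ _).
rewrite big_split /= -add1n leq_add //.
by rewrite (big_rem i) //= Qi pit leq_addr.
Qed.

(** Only an inequality, since [us] may list a part several times. *)
Lemma sumn_le_sum_count (t us : seq nat) :
  {subset t <= us} -> sumn t <= \sum_(x <- us) count_mem x t * x.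
Proof.
elim: t => [|y t IH] //= tus.
have {}IH : sumn t <= \sum_(x <- us) count_mem x t * x.
  by apply: IH => x xt; apply: tus; rewrite inE xt orbT.
have yus : y \in us by apply: tus; rewrite mem_head.
under eq_bigr => x _ do rewrite mulnDl.
rewrite big_split /= leq_add //.
by rewrite (big_rem y) //= eqxx mul1n leq_addr.
Qed.

(** * Alternate sums of Fibonacci numbers *)

Lemma F_step (n : nat) : F n.+2 = F n.+1 + F n.
Proof. by []. Qed.

Lemma F_gt0 (n : nat) : 0 < n -> 0 < F n.
Proof.
case: n => // n _; elim: n => [|n IH] //.
by rewrite F_step; lia.
Qed.

(** The sum is [F (n - 3) + F (n - 5) + ...], with [F 0] counted as 1. Passing
    from [n] to [n + 2] adds the term [F (n - 1)] to a sum bounded by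
    [F (n - 2)], which is the Fibonacci recurrence. *)
Lemma sum_F_le (n k : nat) :
  \sum_(1 <= i < k | 2 * i + 1 <= n)
    (F (n - (2 * i + 1)) + (n - (2 * i + 1) == 0)) <= F (n - 2).
Proof.
have [N] := ubnP n; elim: N => // N IHN in n k *; move=> nN.
have [n2|n3] := leqP n 2.
  by rewrite big_nat_cond big_pred0 // => i; lia.
case: n n3 nN => [|[|n]] // n0 nN.
have [k1|k2] := leqP k 1; first by rewrite big_geq.
case: k k2 => // k k2.
rewrite big_mkcond big_ltn // big_add1 /= -big_mkcond /=.
have -> : 3 <= n.+2 by lia.
have rest : \sum_(1 <= i < k | 2 * i.+1 + 1 <= n.+2)
    (F (n.+2 - (2 * i.+1 + 1)) + (n.+2 - (2 * i.+1 + 1) == 0)) <= F (n - 2).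
  apply: leq_trans (IHN n k _); last lia.
  rewrite leq_eqVlt; apply/orP; left; apply/eqP.
  apply: eq_big => [i|i _]; first by lia.
  by have -> : n.+2 - (2 * i.+1 + 1) = n - (2 * i + 1) by lia.
apply: leq_trans (leq_add (leqnn _) rest) _.
case: n {nN rest IHN} n0 => [|[|n]] // _.
have -> : n.+4 - (2 * 1 + 1) = n.+1 by lia.
by rewrite !subSS !subn0 addn0.
Qed.

(** * Partitions into parts from a fast growing sequence *)

Section FibonacciBound.

Variables (A : set nat) (a : nat -> nat).
Hypothesis enumA : increasing_enumeration A a.
Hypothesis a1_gt0 : 0 < a 1.
Hypothesis a_dominates : forall s, 2 <= s ->
  \sum_(1 <= i < s) 2 * i * a (s - i) < a s.

Lemma enum_lt (i j : nat) : 0 < i -> i < j -> a i < a j.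
Proof. by move=> i0 ij; apply: enumA.1; rewrite ?inE //; lia. Qed.

Lemma enum_ge (i : nat) : i <= a i.
Proof.
elim: i => // -[|i] IH //.
by apply: leq_ltn_trans IH _; apply: enum_lt.
Qed.

Lemma part_enum (m n x : nat) (t : seq nat) :
  is_partition m n A t -> x \in t -> exists i, [/\ 0 < i, a i = x & x <= m].
Proof.
move=> [_ _ tA smt] xt; have := tA x xt.
rewrite -enumA.2 => -[i /= i0 aix]; exists i; split => //.
by rewrite -smt (perm_sumn (perm_to_rem xt)) leq_addr.
Qed.

(** Otherwise [m], the sum of the parts, would be at most the sum of the
    [2 * i * a (s - i)], which is less than [a s]. *)
Lemma frequent_part (m n s : nat) (t : seq nat) :
  0 < s -> a s <= m < a s.+1 -> is_partition m n A t -> a s \notin t ->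
  exists i, [/\ i \in index_iota 1 s, 2 * i + 1 <= n
                & 2 * i + 1 <= count_mem (a (s - i)) t].
Proof.
move=> s0 /andP[asm mas] tP ast; have [_ szt _ smt] := tP.
have [/hasP[i ir ct]|/hasPn noi] :=
  boolP (has (fun i => 2 * i + 1 <= count_mem (a (s - i)) t) (index_iota 1 s)).
  exists i; split => //.
  exact: leq_trans ct (leq_trans (count_size _ _) szt).
exfalso.
have tus : {subset t <= [seq a (s - i) | i <- index_iota 1 s]}.
  move=> x xt; have [j [j0 ajx xm]] := part_enum tP xt.
  have js : j < s.
    have [//|sj|sj] := ltngtP j s; last by move: ast; rewrite -sj ajx xt.
    suff : a s.+1 <= a j by lia.
    move: sj; rewrite leq_eqVlt => /orP[/eqP <- //|sj].
    by apply: ltnW; apply: enum_lt.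
  apply/mapP; exists (s - j); first by rewrite mem_index_iota; lia.
  by rewrite subKn // ltnW.
have := sumn_le_sum_count tus; rewrite smt big_map => mle.
have : m <= \sum_(1 <= i < s) 2 * i * a (s - i).
  apply: leq_trans mle _; rewrite big_seq [leqRHS]big_seq; apply: leq_sum => i ir.
  by rewrite leq_mul2r; apply/orP; right; have := noi i ir; lia.
have [s2|s1] := leqP 2 s; first by have := a_dominates s2; lia.
have -> : s = 1 by lia.
have : a 1 <= m by have -> : 1 = s by lia.
by rewrite big_geq //; lia.
Qed.

Lemma bracket (m : nat) : a 1 <= m -> exists2 s, 0 < s & a s <= m < a s.+1.
Proof.
move=> a1m; pose p s := (0 < s) && (a s <= m).
have ex : exists s, p s by exists 1; rewrite /p a1m.
have ub s : p s -> s <= m by case/andP=> _; apply: leq_trans (enum_ge s).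
have [s /andP[s0 asm] smax] := ex_maxnP ex ub.
exists s => //; rewrite asm ltnNge; apply/negP => am.
by have := smax s.+1; rewrite /p am ltnn => /(_ isT).
Qed.

(** The term [n == 0] accounts for the empty partition of 0, which exists even
    when no part is allowed. *)
Lemma P_le_F (m n : nat) : P m n A <= F n + (n == 0).
Proof.
have [N] := ubnP n; elim: N => // N IHN in m n *; rewrite ltnS => nN.
have [L [uL LP <-]] := exists_partition_list m n A.
have [ma1|a1m] := ltnP m (a 1).
  (* Every part is at least [a 1 > m], so only the empty partition remains. *)
  have Lnil : {subset L <= [:: [::]]}.
    move=> [|x t] // /LP tP.
    have [i [i0 aix xm]] := part_enum tP (mem_head x t).
    have : a 1 <= a i by case: i i0 {aix} => [|[|i]] // _; apply/ltnW/enum_lt.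
    by rewrite aix; lia.
  apply: (leq_trans (uniq_leq_size uL Lnil)) => /=.
  by case: (n) (@F_gt0 n) => // k /(_ isT); lia.
have [s s0 sm] := bracket a1m.
have asm : a s <= m by case/andP: sm.
have a_s0 : 0 < a s by apply: leq_trans (enum_ge s).
case: n => [|n] in nN LP *.
  apply: (leq_trans (uniq_leq_size (s2 := [:: [::]]) uL _)) => // t /LP[_].
  by rewrite leqn0 => /nilP ->.
have with_as : count (fun t => a s \in t) L <= F n + (n == 0).
  rewrite -size_filter; apply: leq_trans (IHN (m - 1 * a s) n nN).
  have -> : P (m - 1 * a s) n A = P (m - 1 * a s) (n.+1 - 1) A by rewrite subn1.
  apply: size_partitions_copies_le; first exact: filter_uniq.
  move=> t; rewrite mem_filter => /andP[ast /LP tP]; split => //.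
  by rewrite -has_count has_pred1.
have without_as : count (fun t => a s \notin t) L <= F (n.+1 - 2).
  rewrite -size_filter; set L' := filter _ L.
  have L'P t : t \in L' -> is_partition m n.+1 A t /\ a s \notin t.
    by rewrite mem_filter => /andP[? /LP].
  apply: leq_trans (sum_F_le n.+1 s).
  pose p i t := 2 * i + 1 <= count_mem (a (s - i)) t.
  apply: (leq_trans (size_le_sum_count (r := index_iota 1 s)
    (Q := fun i => 2 * i + 1 <= n.+1) (p := p) _)).
    by move=> t /L'P[tP ast]; apply: frequent_part tP ast.
  apply: leq_sum => i i_n; rewrite -size_filter.
  apply: leq_trans (IHN (m - (2 * i + 1) * a (s - i)) _ _); last lia.
  apply: size_partitions_copies_le; first by rewrite !filter_uniq.
  by move=> t; rewrite mem_filter => /andP[? /L'P[]].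
rewrite -(count_predC (fun t => a s \in t) L).
apply: (leq_trans (leq_add with_as without_as)).
by case: (n) => [|k] //; rewrite !subSS subn0 F_step; lia.
Qed.

End FibonacciBound.

(** * Powers of [q] *)

Lemma powers_enumeration (q : nat) :
  1 < q -> increasing_enumeration (powers q) (fun i => q ^ (i - 1)).
Proof.
move=> q1; split.
  by move=> i j; rewrite !inE => i0 j0 ij; rewrite ltn_exp2l //; lia.
apply/seteqP; split => [_ [i _ <-]|_ [i _ <-]]; first by exists (i - 1).
by exists i.+1 => //=; rewrite subn1.
Qed.

(** Write [S s] for the sum. Then [S (s + 1) = q * S s + 2 * s] and [S 1 = 0].
    The strict inequality is not inductive because of the term [2 * s], so a
    linear slack is carried along. *)
Lemma powers_dominate (q s : nat) : 3 < q -> 2 <= s ->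
  \sum_(1 <= i < s) 2 * i * q ^ (s - i - 1) < q ^ (s - 1).
Proof.
move=> q3; case: s => // s _.
(* For [q = 4], [S s + c s <= q ^ (s - 1)] is inductive if
   [4 * c s = 2 * s + c (s + 1)]; the linear solution is
   [c s = (6 * s + 2) / 9]. *)
suff : 9 * \sum_(1 <= i < s.+1) 2 * i * q ^ (s.+1 - i - 1) + (6 * s.+1 + 2)
       <= 9 * q ^ (s.+1 - 1) by lia.
elim: s => [|s IH]; first by rewrite big_geq.
have rec : \sum_(1 <= i < s.+2) 2 * i * q ^ (s.+2 - i - 1) =
    q * \sum_(1 <= i < s.+1) 2 * i * q ^ (s.+1 - i - 1) + 2 * s.+1.
  rewrite big_nat_recr //=; have -> : s.+2 - s.+1 - 1 = 0 by lia.
  rewrite muln1 big_distrr /=; congr (_ + _).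
  apply: eq_big_nat => i /andP[i1 i_s].
  have -> : s.+2 - i - 1 = (s.+1 - i - 1).+1 by lia.
  by rewrite expnS mulnCA.
rewrite rec; move: IH; set S := \sum_(1 <= i < s.+1) _.
have -> : s.+2 - 1 = (s.+1 - 1).+1 by lia.
rewrite expnS; set Q := q ^ _ => IH.
have := leq_mul (leqnn q) IH; have := leq_mul q3 (leqnn (6 * s.+1 + 2)).
by lia.
Qed.

Theorem theorem2p3 (q : nat) (hq : 3 < q) :
  let a := fun i : nat => q ^ (i - 1) in
  [/\ increasing_enumeration (powers q) a,
      forall s : nat, 2 <= s ->
        \sum_(1 <= i < s) 2 * i * a (s - i) < a s
    & forall m n : nat, 0 < m -> 0 < n -> P m n (powers q) <= F n].
Proof.
move=> a.
have enum : increasing_enumeration (powers q) a.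
  by apply: powers_enumeration; lia.
have dom s : 2 <= s -> \sum_(1 <= i < s) 2 * i * a (s - i) < a s.
  exact: powers_dominate.
split => // m n _ n0.
have := P_le_F enum (isT : 0 < a 1) dom m n.
by rewrite (gtn_eqF n0) addn0.
Qed.
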